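(* Let $A$ be a finite alphabet, $\varphi(P_1,\ldots,P_\ell)$ an MSO sentence over $A$ with monadic predicate symbols $P_1,\ldots,P_\ell$, and $\mathbf{P}_1,\ldots,\mathbf{P}_\ell \subseteq \mathbb{N}$ uniform monadic predicates such that the language $L_{\varphi,\mathbf{P}_1,\ldots,\mathbf{P}_\ell}$ of infinite words is $\omega$-regular. Then there exist regular uniform monadic predicates $\mathbf{Q}_1,\ldots,\mathbf{Q}_\ell \subseteq\mathbb{N}$ such that $L_{\varphi,\mathbf{P}_1,\ldots,\mathbf{P}_\ell} = L_{\varphi,\mathbf{Q}_1,\ldots,\mathbf{Q}_\ell}$.
   Context: Here formulae are interpreted over infinite words $u = u_0u_1u_2\cdots\in A^\omega$, whose positions are the natural numbers. MSO formulae are built from $\mathbf{a}(x)$ ($a\in A$), $x \le y$, $P(x)$, Boolean connectives, and first-order and monadic second-order quantification over positions. A uniform monadic predicate is a set $\mathbf{P}\subseteq\mathbb{N}$, and $P(x)$ holds iff $x\in\mathbf{P}$. $L_{\varphi,\mathbf{P}_1,\ldots,\mathbf{P}_\ell} = \{u\in A^\omega\mid u,\mathbf{P}_1,\ldots,\mathbf{P}_\ell\models\varphi\}$. A uniform predicate $\mathbf{Q}\subseteq\mathbb{N}$ is regular if it is ultimately periodic, i.e. its characteristic infinite word in $\{0,1\}^\omega$ is ultimately periodic (equivalently, $\mathbf{Q}$ is a Boolean combination of singletons $\{c\}$ and residue classes $\{x\mid x\equiv r\bmod q\}$). *)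

(* Defs.v *)
From mathcomp Require Import all_boot.
From mathcomp Require Import boolp classical_sets.

Set Implicit Arguments.
Unset Strict Implicit.
Unset Printing Implicit Defensive.

Local Open Scope classical_set_scope.

Definition omega_word (A : Type) := nat -> A.

(* [mso A l n m]: MSO formulae over the alphabet A with l uniform predicate
   symbols, n free first-order variables and m free set variables, in
   well-scoped de Bruijn style: a quantifier binds variable 0 of its body. *)
Inductive mso (A : finType) (l : nat) : nat -> nat -> Type :=
| Letter n m of A & 'I_n : mso A l n m
| Le n m of 'I_n & 'I_n : mso A l n m
| Pred n m of 'I_l & 'I_n : mso A l n m
| Mem n m of 'I_m & 'I_n : mso A l n m
| Neg n m of mso A l n m : mso A l n m
| And n m of mso A l n m & mso A l n m : mso A l n m
| Or n m of mso A l n m & mso A l n m : mso A l n m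
| Ex1 n m of mso A l n.+1 m : mso A l n m
| All1 n m of mso A l n.+1 m : mso A l n m
| Ex2 n m of mso A l n m.+1 : mso A l n m
| All2 n m of mso A l n m.+1 : mso A l n m.

Definition mso_sentence (A : finType) (l : nat) := mso A l 0 0.

Definition extend (T : Type) (n : nat) (t : T) (v : 'I_n -> T) (i : 'I_n.+1) : T :=
  if unlift ord0 i is Some j then v j else t.

Fixpoint sat (A : finType) (l : nat) (u : omega_word A) (P : 'I_l -> set nat)
    (n m : nat) (phi : mso A l n m) :
    ('I_n -> nat) -> ('I_m -> set nat) -> Prop :=
  match phi in mso _ _ n m return ('I_n -> nat) -> ('I_m -> set nat) -> Prop with
  | Letter _ _ a x => fun v V => u (v x) = a
  | Le _ _ x y => fun v V => (v x <= v y)%N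
  | Pred _ _ i x => fun v V => P i (v x)
  | Mem _ _ X x => fun v V => V X (v x)
  | Neg _ _ f => fun v V => ~ sat u P f v V
  | And _ _ f g => fun v V => sat u P f v V /\ sat u P g v V
  | Or _ _ f g => fun v V => sat u P f v V \/ sat u P g v V
  | Ex1 _ _ f => fun v V => exists x : nat, sat u P f (extend x v) V
  | All1 _ _ f => fun v V => forall x : nat, sat u P f (extend x v) V
  | Ex2 _ _ f => fun v V => exists X : set nat, sat u P f v (extend X V)
  | All2 _ _ f => fun v V => forall X : set nat, sat u P f v (extend X V)
  end.

(* A sentence has no free variable ('I_0 is empty), so the values of the
   constant valuations are never used. *)
Definition mso_language (A : finType) (l : nat) (phi : mso_sentence A l)
    (P : 'I_l -> set nat) : set (omega_word A) :=
  [set u | sat u P phi (fun=> 0%N) (fun=> set0)].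

Record buchi (A : finType) := Buchi {
  state : finType;
  init : {set state};
  step : state -> A -> {set state};
  accepting : {set state}
}.

Definition buchi_language (A : finType) (B : buchi A) : set (omega_word A) :=
  [set u | exists r : nat -> state B,
    [/\ r 0%N \in init B,
        forall i, r i.+1 \in step (r i) (u i) &
        forall i, exists2 j, (i <= j)%N & r j \in accepting B]].

Definition omega_regular (A : finType) (L : set (omega_word A)) : Prop :=
  exists B : buchi A, L = buchi_language B.

Definition ultimately_periodic (T : Type) (w : omega_word T) : Prop :=
  exists N p : nat,
    (0 < p)%N /\ forall i : nat, (N <= i)%N -> w (i + p)%N = w i.

Definition char_word (Q : set nat) : omega_word bool := fun i => i \in Q.

Definition regular_predicate (Q : set nat) : Prop :=
  ultimately_periodic (char_word Q).

(* Main.v *)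
Require Import Defs.
From mathcomp Require Import all_boot.
From mathcomp Require Import boolp classical_sets.

Set Implicit Arguments.
Unset Strict Implicit.
Unset Printing Implicit Defensive.

Local Open Scope classical_set_scope.

(** Let L be the given omega-regular language.  The words over {0,1}^l encoding
the tuples P with L_(phi, P) = L form an MSO definable set, so it suffices that
a nonempty MSO definable set E contains an ultimately periodic word.  Call E
recognizable when some finite colouring of finite words is such that membership
in E depends only on the sequence of colours of the factors of a word, whatever
the factorization.  No morphism property is asked of the colouring, so
complementation is free and projection is a powerset construction; determinization
and Büchi complementation are avoided.  Ramsey's theorem enters only once: it
factors a word of E as w0 w1 w2 ... with w1, w2, ... of the same colour, and
then w0 w1 w1 w1 ... is in E as well. *)

(** * Factorizations of infinite words into nonempty finite words *)

Definition cuts (s : nat -> nat) : Prop :=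
  s 0 = 0 /\ forall j, s j < s j.+1.

Definition factor (S : Type) (x : omega_word S) (s : nat -> nat) (j : nat) :
    seq S :=
  [seq x i | i <- index_iota (s j) (s j.+1)].

(** The two words may be cut at unrelated positions. One implication suffices, since the condition
    is symmetric in the two words. *)
Definition recognizable (S : finType) (K : set (omega_word S)) : Prop :=
  exists (M : finType) (h : seq S -> M), forall s t x y,
    cuts s -> cuts t -> (forall j, h (factor x s j) = h (factor y t j)) ->
    K x -> K y.

Lemma cuts_leq s i j : cuts s -> i <= j -> s i <= s j.
Proof. by move=> [_ ds]; apply: (homo_leq leqnn leq_trans) => k; exact: ltnW. Qed.

Lemma cuts_ge s i : cuts s -> i <= s i.
Proof. by move=> [_ ds]; elim: i => // i IHi; exact: leq_ltn_trans (ds i). Qed.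

Lemma cuts_cover s i : cuts s -> exists j, s j <= i < s j.+1.
Proof.
move=> cs; elim: i => [|i [j /andP[ji ij]]].
  by exists 0; case: cs => s0 ds; rewrite s0 /= -{1}s0 ds.
have [lt_i|le_i] := ltnP i.+1 (s j.+1); first by exists j; rewrite lt_i ltnW.
exists j.+1; rewrite le_i /=.
by apply: leq_ltn_trans ij _; case: cs => _ ds.
Qed.

Lemma cuts_uniq s i j k : cuts s ->
  s j <= i < s j.+1 -> s k <= i < s k.+1 -> j = k.
Proof.
move=> cs; wlog lt_jk : j k / j < k => [hw|] hj hk.
  by case: (ltngtP j k) => // h; [apply: hw|apply/esym/hw].
have := cuts_leq cs lt_jk; case/andP: hj => _ hj; case/andP: hk => hk _.
by move/(leq_trans hj) => /leq_trans/(_ hk); rewrite ltnn.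
Qed.

Lemma size_factor S (x : omega_word S) s j :
  size (factor x s j) = s j.+1 - s j.
Proof. by rewrite size_map size_iota. Qed.

Lemma nth_factor S (z : S) (x : omega_word S) s j i :
  i < s j.+1 - s j -> nth z (factor x s j) i = x (s j + i).
Proof. by move=> hi; rewrite (nth_map 0) ?size_iota // nth_iota. Qed.

Lemma map_factor S T (f : S -> T) (x : omega_word S) s j :
  map f (factor x s j) = factor (f \o x) s j.
Proof. by rewrite -map_comp. Qed.

(** * Closure under Boolean operations, relabelling and projection *)

Section Closure.
Variable S : finType.
Implicit Types K : set (omega_word S).

Lemma recognizable_ext K K' :
  (forall x, K x <-> K' x) -> recognizable K -> recognizable K'.
Proof.
move=> e [M [h hK]]; exists M, h => s t x y cs ct hxy /e Kx.
by apply/e; exact: (hK s t x).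
Qed.

Lemma recognizable_compl K : recognizable K -> recognizable [set x | ~ K x].
Proof.
move=> [M [h hK]]; exists M, h => s t x y cs ct hxy Kx Ky.
by apply: Kx; apply: (hK t s y) => // j; exact/esym/hxy.
Qed.

Lemma recognizable_and K K' : recognizable K -> recognizable K' ->
  recognizable [set x | K x /\ K' x].
Proof.
move=> [M [h hK]] [M' [h' hK']].
exists (M * M')%type, (fun w => (h w, h' w)) => s t x y cs ct hxy [Kx K'x].
by split; [apply: (hK s t x)|apply: (hK' s t x)] => // j; have [] := hxy j.
Qed.

Lemma recognizable_or K K' : recognizable K -> recognizable K' ->
  recognizable [set x | K x \/ K' x].
Proof.
move=> rK rK'; apply: recognizable_ext (recognizable_compl
  (recognizable_and (recognizable_compl rK) (recognizable_compl rK'))) => x /=.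
by case: (pselect (K x)); case: (pselect (K' x)); tauto.
Qed.

Lemma recognizable_iff K K' : recognizable K -> recognizable K' ->
  recognizable [set x | K x <-> K' x].
Proof.
move=> rK rK'; apply: recognizable_ext (recognizable_or (recognizable_and rK rK')
  (recognizable_and (recognizable_compl rK) (recognizable_compl rK'))) => x /=.
by case: (pselect (K x)); case: (pselect (K' x)); tauto.
Qed.

End Closure.

Lemma recognizable_preimage (S T : finType) (f : T -> S)
    (K : set (omega_word S)) :
  recognizable K -> recognizable [set x : omega_word T | K (f \o x)].
Proof.
move=> [M [h hK]]; exists M, (h \o map f) => s t x y cs ct hxy.
by apply: (hK s t) => // j; rewrite -(map_factor f x) -(map_factor f y); exact: hxy.
Qed.

(* The image of a factor is the set of colours of its lifts, so a lift of one
   word is transported factor by factor to a lift of the other. *)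
Lemma recognizable_exists (S T : finType) (K : set (omega_word (S * T))) : recognizable K ->
  recognizable [set x | exists y : omega_word T, K (fun i => (x i, y i))].
Proof.
move=> [M [h hK]].
pose H w := [set m | `[< exists2 v, map fst v = w & h v = m >]]%SET.
exists {set M}, H => s t x x' cs ct hxx' [y Ky].
have lift j : exists v, map fst v = factor x' t j /\
    h v = h (factor (fun i => (x i, y i)) s j).
  have : h (factor (fun i => (x i, y i)) s j) \in H (factor x' t j).
    rewrite -hxx' inE; apply/asboolP; exists (factor (fun i => (x i, y i)) s j) => //.
    by rewrite map_factor.
  by rewrite inE => /asboolP[v]; exists v.
have [v hv] := choice lift.
have [b hb] := choice (fun i => cuts_cover i ct).
(* [b i] is the index of the factor of [x'] containing [i], so [y'] glues the lifts together and the
   default pair is never reached. *)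
pose y' i := (nth (x 0, y 0) (v (b i)) (i - t (b i))).2.
exists y'; apply: (hK s t _ _ cs ct _ Ky) => j; have [e1 <-] := hv j; congr h.
have sz : size (v j) = t j.+1 - t j by rewrite -(size_map fst) e1 size_factor.
apply: (@eq_from_nth _ (x 0, y 0)); rewrite ?size_factor // => i hi.
rewrite sz in hi; rewrite nth_factor //.
have -> : y' (t j + i) = (nth (x 0, y 0) (v j) i).2.
  have bj : b (t j + i) = j.
    by apply: (cuts_uniq ct (hb _)); rewrite leq_addr /= -ltn_subRL.
  by rewrite /y' bj addKn.
rewrite -(nth_factor (x 0) x') // -e1 (nth_map (x 0, y 0)) ?sz //.
by case: nth.
Qed.

Lemma recognizable_forall (S T : finType) (K : set (omega_word (S * T))) : recognizable K ->
  recognizable [set x | forall y : omega_word T, K (fun i => (x i, y i))].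
Proof.
move=> rK; apply: recognizable_ext (recognizable_compl (recognizable_exists
  (recognizable_compl rK))) => x /=.
by split=> [nK y|Ky [y /(_ (Ky y))//]]; apply: contrapT => Ky; apply: nK; exists y.
Qed.

(** * Recognizable conditions on the letters of a word *)

Section Atoms.
Variable S : finType.

(** Cuts begin at 0 and factors are nonempty, so the colour of the first factor reveals [x 0]. *)
Lemma recognizable_first (p : pred S) :
  recognizable [set x : omega_word S | p (x 0)].
Proof.
exists (option S), ohead => s t x y [s0 ds] [t0 dt] /(_ 0).
rewrite /factor s0 t0 /index_iota !subn0.
have := ds 0; have := dt 0; rewrite s0 t0.
by case: (s 1) => // ? _; case: (t 1) => // ? _ [] /= ->.
Qed.

(** Adjacent positions lie in one factor or on both sides of a cut. Sortedness of the factor settles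
    the first case, the last and first letters of neighbouring factors the second. *)
Lemma recognizable_local (R : rel S) :
  recognizable [set x : omega_word S | forall i, R (x i) (x i.+1)].
Proof.
pose h w := (ohead w, last None (map some w), sorted R w).
have headE (x : omega_word S) s j : cuts s ->
    ohead (factor x s j) = Some (x (s j)).
  move=> [_ ds]; have := ds j; rewrite -subn_gt0 /factor /index_iota.
  by case: (_ - _).
have lastE (x : omega_word S) s j : cuts s ->
    last None (map some (factor x s j)) = Some (x (s j.+1).-1).
  move=> [_ ds]; have := ds j; rewrite -subn_gt0 => d0.
  rewrite -nth_last size_map size_factor (nth_map (x 0)) ?size_factor ?ltn_predL //.
  rewrite nth_factor ?ltn_predL //; congr (Some (x _)).
  by rewrite -subn1 addnBA // subnKC ?subn1 // ltnW.
exists (option S * option S * bool)%type, h => s t x y cs ct hxy Rx i.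
have [j /andP[ji ij]] := cuts_cover i ct.
have [eh el es] := hxy j.
have [lt_i|] := ltnP i.+1 (t j.+1).
  have : sorted R (factor x s j).
    apply/(sortedP (x 0)) => k; rewrite size_factor => hk.
    by rewrite !nth_factor ?addnS // ltnW.
  rewrite es => /(sortedP (x 0)) /(_ (i - t j)).
  rewrite size_factor -subSn // ltn_sub2r // ?(leq_ltn_trans ji) // => /(_ isT).
  by rewrite !nth_factor ?ltn_sub2r ?(leq_ltn_trans ji) // !subnKC // (leqW ji).
(* Here [i] is the last position of factor [j] and [i.+1] the first of the next one. *)
rewrite leq_eqVlt ltnNge ij orbF => /eqP ei.
have [eh' _ _] := hxy j.+1.
move: el eh'; rewrite !lastE // !headE // => -[] + [].
rewrite ei /= => <- <-.
have := Rx (s j.+1).-1; rewrite prednK //.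
by case: cs => _ ds; exact: leq_ltn_trans (ds j).
Qed.

Lemma recognizable_some (p : pred S) :
  recognizable [set x : omega_word S | exists i, p (x i)].
Proof.
apply: recognizable_ext
  (recognizable_compl (recognizable_local (fun a _ => ~~ p a))) => x /=.
split=> [nx|[i pi] /(_ i)]; last by rewrite pi.
by apply: contrapT => np; apply: nx => i; apply/negP => pi; apply: np; exists i.
Qed.

(** Factors are finite, so [p] holds infinitely often iff infinitely many factors contain a letter
    satisfying it. *)
Lemma recognizable_infinitely_often (p : pred S) :
  recognizable [set x : omega_word S | forall i, exists2 j, i <= j & p (x j)].
Proof.
exists bool, (has p) => s t x y cs ct hxy px i.
(* A position beyond [s i] lies in a factor of index at least [i], and the factor of [y] with that
   index starts at [i] or later. *)
have [k ik pk] := px (s i).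
have [j /andP[jk kj]] := cuts_cover k cs.
have : has p (factor x s j).
  by rewrite has_map; apply/hasP; exists k => //; rewrite mem_index_iota jk.
rewrite hxy has_map => /hasP[m]; rewrite mem_index_iota => /andP[jm _] pm.
exists m => //; apply: leq_trans (cuts_ge i ct) _; apply: leq_trans jm.
apply: cuts_leq => //; rewrite -ltnS ltnNge; apply/negP => /(cuts_leq cs).
by move=> /(leq_trans kj) /leq_trans /(_ ik); rewrite ltnn.
Qed.

End Atoms.

(* The auxiliary word marks an upward closed set that separates i from j. *)
Lemma recognizable_lt (S : finType) (p q : pred S) :
  recognizable [set x : omega_word S | exists i j, [/\ i < j, p (x i) & q (x j)]].
Proof.
apply: recognizable_ext (recognizable_exists (recognizable_and
  (recognizable_local (fun a b : S * bool => a.2 ==> b.2))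
  (recognizable_and (recognizable_some (fun a : S * bool => p a.1 && ~~ a.2))
    (recognizable_some (fun a : S * bool => q a.1 && a.2))))) => x /=.
split=> [[y [my [[i /andP[pi yi]] [j /andP[qj yj]]]]]|[i [j [ij pi qj]]]].
  exists i, j; split=> //; rewrite ltnNge; apply/negP => ji.
  case/negP: yi; move: ji; clear pi.
  elim: i => [|i IHi]; first by rewrite leqn0 => /eqP <-.
  rewrite leq_eqVlt => /orP[/eqP <- //|ji].
  by apply: (implyP (my i)); exact: IHi.
exists (ltn i); split=> [k|]; first by apply/implyP => /ltnW.
by split; [exists i; rewrite pi /= ltnn|exists j; rewrite qj].
Qed.

Lemma recognizable_le (S : finType) (p q : pred S) :
  recognizable [set x : omega_word S | exists i j, [/\ i <= j, p (x i) & q (x j)]].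
Proof.
apply: recognizable_ext (recognizable_or (recognizable_lt p q)
  (recognizable_some (fun a => p a && q a))) => x /=.
split=> [[[i [j [/ltnW ij pi qj]]]|[i /andP[pi qi]]]|[i [j []]]].
- by exists i, j.
- by exists i, i.
- rewrite leq_eqVlt => /orP[/eqP <- pi qi|ij pi qj].
    by right; exists i; rewrite pi.
  by left; exists i, j.
Qed.

(** A set is a singleton iff it is nonempty and has no two elements [i < j]. *)
Lemma recognizable_singleton :
  recognizable [set y : omega_word bool | exists t, y = pred1 t].
Proof.
apply: recognizable_ext (recognizable_and (recognizable_some id)
  (recognizable_compl (recognizable_lt id id))) => y /=.
split=> [[[t yt] ny]|[t ->]].
  exists t; apply/funext => i /=; apply/idP/eqP => [yi|-> //].
  by case: (ltngtP i t) => // h; case: ny; [exists i, t|exists t, i].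
split; first by exists t => /=.
by move=> [i [j [ij /eqP it /eqP jt]]]; rewrite it jt ltnn in ij.
Qed.

(** The run is the projected auxiliary word: being initial, following the transitions and accepting
    are conditions on the first letter, on adjacent letters and on infinitely many letters. *)
Lemma recognizable_buchi (A : finType) (B : buchi A) :
  recognizable (buchi_language B).
Proof.
apply: recognizable_ext (recognizable_exists (recognizable_and
  (recognizable_first (fun a : A * state B => a.2 \in init B))
  (recognizable_and
    (recognizable_local (fun a b : A * state B => b.2 \in step a.2 a.1))
    (recognizable_infinitely_often
       (fun a : A * state B => a.2 \in accepting B))))) => u /=.
by split=> [[r [? [? ?]]]|[r [? ? ?]]]; exists r.
Qed.

(** * MSO formulae define recognizable sets of encodings *)

Section Formulae.
Variables (A : finType) (l : nat).

Definition letter (n m : nat) : finType :=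
  (A * {ffun 'I_l -> bool} * {ffun 'I_n -> bool} * {ffun 'I_m -> bool})%type.

(* First-order variables are encoded as singletons. *)
Definition encode (u : omega_word A) (P : 'I_l -> set nat) n m
    (v : 'I_n -> nat) (V : 'I_m -> set nat) : omega_word (letter n m) :=
  fun i => (u i, [ffun k => `[< P k i >]], [ffun k => i == v k],
            [ffun k => `[< V k i >]]).

Definition extend1 n m (a : letter n m * bool) : letter n.+1 m :=
  (a.1.1.1, [ffun k => extend a.2 a.1.1.2 k], a.1.2).

Definition extend2 n m (a : letter n m * bool) : letter n m.+1 :=
  (a.1.1, [ffun k => extend a.2 a.1.2 k]).

Lemma encode_extend1 u P n m (v : 'I_n -> nat) (V : 'I_m -> set nat) t :
  (@extend1 n m) \o (fun i => (encode u P v V i, pred1 t i)) =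
  encode u P (extend t v) V.
Proof.
apply/funext => i; rewrite /= /extend1 /encode /=; congr (_, _, _).
by apply/ffunP => k; rewrite !ffunE /extend; case: unlift => // j; rewrite ffunE.
Qed.

Lemma encode_extend2 u P n m (v : 'I_n -> nat) (V : 'I_m -> set nat) X :
  (@extend2 n m) \o (fun i => (encode u P v V i, `[< X i >])) =
  encode u P v (extend X V).
Proof.
apply/funext => i; rewrite /= /extend2 /encode /=; congr (_, _).
by apply/ffunP => k; rewrite !ffunE /extend; case: unlift => // j; rewrite ffunE.
Qed.

(** [K] is arbitrary on words that encode nothing, so negation is plain complement. One [K] serves
    all [P], because the predicates are tracks of the word. *)
Definition definable n m (F : omega_word A -> ('I_l -> set nat) ->
    ('I_n -> nat) -> ('I_m -> set nat) -> Prop) : Prop :=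
  exists2 K : set (omega_word (letter n m)), recognizable K &
    forall u P v V, K (encode u P v V) <-> F u P v V.

Lemma definable_ext n m F G :
  (forall u P v V, F u P v V <-> G u P v V) -> @definable n m F -> definable G.
Proof.
move=> FG [K rK hK]; exists K => // u P v V.
by rewrite hK.
Qed.

Lemma definable_not n m F : @definable n m F ->
  @definable n m (fun u P v V => ~ F u P v V).
Proof.
move=> [K rK hK]; exists [set x | ~ K x]; first exact: recognizable_compl.
by move=> u P v V /=; rewrite hK.
Qed.

Lemma definable_and n m F G : @definable n m F -> @definable n m G ->
  @definable n m (fun u P v V => F u P v V /\ G u P v V).
Proof.
move=> [K rK hK] [K' rK' hK']; exists [set x | K x /\ K' x].
  exact: recognizable_and.
by move=> u P v V /=; rewrite hK hK'.
Qed.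

(** Restricting the new track to singletons makes it the encoding of a position. *)
Lemma definable_exists1 n m F : @definable n.+1 m F ->
  @definable n m (fun u P v V => exists t, F u P (extend t v) V).
Proof.
move=> [K rK hK]; eexists.
  apply: recognizable_exists (recognizable_and
    (recognizable_preimage snd recognizable_singleton)
    (recognizable_preimage (@extend1 n m) rK)).
move=> u P v V /=; split=> [[y [[t yE]]]|[t Ft]].
  have -> : y = pred1 t by rewrite -yE.
  by rewrite encode_extend1 hK; exists t.
by exists (pred1 t); split; [exists t|rewrite encode_extend1 hK].
Qed.

Lemma definable_exists2 n m F : @definable n m.+1 F ->
  @definable n m (fun u P v V => exists X, F u P v (extend X V)).
Proof.
move=> [K rK hK]; eexists.
  exact: recognizable_exists (recognizable_preimage (@extend2 n m) rK).
move=> u P v V /=; split=> [[y]|[X FX]].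
  have -> : y = fun i => `[< [set i | y i] i >].
    by apply/funext => i; rewrite /= asboolb.
  by rewrite encode_extend2 hK; exists [set i | y i].
by exists (fun i => `[< X i >]); rewrite encode_extend2 hK.
Qed.

(** In an encoding, track [k] is true at [v k] alone, so that position is found by its mark. *)
Lemma definable_at n m (p : pred (letter n m)) (k : 'I_n) :
  definable (fun u P v V => p (encode u P v V (v k))).
Proof.
exists [set x | exists i, p (x i) && (x i).1.2 k].
  exact: recognizable_some (fun a => p a && a.1.2 k).
move=> u P v V /=; split=> [[i]|pk]; last by exists (v k); rewrite pk ffunE /=.
by rewrite ffunE => /andP[+ /eqP <-].
Qed.

Lemma definable_sat n m (phi : mso A l n m) :
  definable (fun u P v V => sat u P phi v V).
Proof.
elim: phi => {}n {}m.
- move=> a k; apply: definable_ext (definable_at (fun b => b.1.1.1 == a) k).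
  by move=> u P v V /=; split=> /eqP.
- move=> j k; eexists.
    exact: recognizable_le (fun a : letter n m => a.1.2 j)
      (fun a : letter n m => a.1.2 k).
  move=> u P v V /=; split=> [[i [i' []]]|jk].
    by rewrite !ffunE => + /eqP <- /eqP <-.
  by exists (v j), (v k); rewrite !ffunE !eqxx.
- move=> j k; apply: definable_ext (definable_at (fun b => b.1.1.2 j) k).
  by move=> u P v V /=; rewrite ffunE asboolE.
- move=> j k; apply: definable_ext (definable_at (fun b => b.2 j) k).
  by move=> u P v V /=; rewrite ffunE asboolE.
- by move=> f; exact: definable_not.
- by move=> f df g dg; exact: definable_and.
- move=> f df g dg; apply: definable_ext (definable_not
    (definable_and (definable_not df) (definable_not dg))) => u P v V /=.
  by case: (pselect (sat u P f v V)); case: (pselect (sat u P g v V)); tauto.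
- by move=> f; exact: definable_exists1.
- move=> f df; apply: definable_ext
    (definable_not (definable_exists1 (definable_not df))) => u P v V /=.
  by rewrite -forallNP; split=> + t => /(_ t); [exact: contrapT|move=> ? []].
- by move=> f; exact: definable_exists2.
- move=> f df; apply: definable_ext
    (definable_not (definable_exists2 (definable_not df))) => u P v V /=.
  by rewrite -forallNP; split=> + t => /(_ t); [exact: contrapT|move=> ? []].
Qed.

End Formulae.

(** * Ramsey's theorem for pairs of natural numbers *)

Definition unbounded (X : set nat) : Prop := forall n, exists2 k, n <= k & X k.

Section Ramsey.
Variable M : finType.

(** If every colour class were bounded, an element of [X] beyond all the bounds would have no
    colour. *)
Lemma unbounded_pigeonhole (X : set nat) (g : nat -> M) :
  unbounded X -> exists c, unbounded [set k | X k /\ g k = c].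
Proof.
move=> uX; apply: contrapT => /forallNP nc.
have bnd c : exists n, forall k, n <= k -> X k -> g k <> c.
  have /existsNP[n hn] := nc c; exists n => k nk Xk gk.
  by apply: hn; exists k.
have [b hb] := choice bnd.
have [k bk Xk] := uX (\max_c b c).
by apply: (hb (g k) k) => //; apply: leq_trans bk; exact: leq_bigmax.
Qed.

Lemma unbounded_enum (X : set nat) : unbounded X ->
  exists2 t : nat -> nat, forall j, t j < t j.+1 & forall j, X (t j).
Proof.
move=> uX; have next n : exists k, n <= k /\ X k by have [k] := uX n; exists k.
have [f hf] := choice next.
exists (fun j => iter j (f \o S) (f 0)) => [j|[|j]]; first exact: (hf _).1.
  exact: (hf 0).2.
exact: (hf _).2.
Qed.

Lemma ramsey (c : nat -> nat -> M) :
  exists2 t : nat -> nat, forall j, t j < t j.+1 &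
    exists a, forall i j, i < j -> c (t i) (t j) = a.
Proof.
(* One thinning step picks a point, a colour and an unbounded set of later points that all have this
   colour with it. The premise sits under the existential so that [choice] yields a total function
   to iterate. *)
have thin (X : set nat) : exists r : nat * M * set nat, unbounded X ->
    [/\ X r.1.1, unbounded r.2 &
        forall k, r.2 k -> [/\ X k, r.1.1 < k & c r.1.1 k = r.1.2]].
  have [uX|] := pselect (unbounded X); last first.
    (* Dummy triple for a bounded set; [c 0 0] only supplies an element of [M]. *)
    by have := c 0 0 => a nX; exists (0, a, set0).
  have [n _ Xn] := uX 0.
  have uY : unbounded [set k | X k /\ n < k].
    move=> k; have [k' kk' Xk'] := uX (maxn k n.+1).
    by move: kk'; rewrite geq_max => /andP[? ?]; exists k'.
  have [a ua] := unbounded_pigeonhole (c n) uY.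
  by exists (n, a, [set k | (X k /\ n < k) /\ c n k = a]); split=> // k [[]].
have [f hf] := choice thin.
pose X k := iter k (fun Y => (f Y).2) setT.
have uX k : unbounded (X k).
  elim: k => [n|k /hf[]//]; by exists n.
have subX i j : i <= j -> X j `<=` X i.
  elim: j => [|j IHj]; first by rewrite leqn0 => /eqP ->.
  rewrite leq_eqVlt => /orP[/eqP -> //|/IHj ij] k.
  by have [_ _ h] := hf _ (uX j) => /h[/ij].
(* The colour of two chosen points depends on the earlier one alone. *)
have aP i j : i < j -> (f (X i)).1.1 < (f (X j)).1.1 /\
    c (f (X i)).1.1 (f (X j)).1.1 = (f (X i)).1.2.
  move=> ij; have [Xj _ _] := hf _ (uX j); have [_ _ h] := hf _ (uX i).
  by have [] := h _ (subX _ _ ij _ Xj).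
(* The pigeonhole principle makes this colour constant on a subsequence. *)
have [|a ua] := @unbounded_pigeonhole setT (fun k => (f (X k)).1.2).
  by move=> n; exists n.
have [t dt ht] := unbounded_enum ua.
have lt_t := homo_ltn ltn_trans dt.
exists (fun j => (f (X (t j))).1.1) => [j|]; first by have [] := aP _ _ (dt j).
exists a => i j ij; have [_ ->] := aP _ _ (lt_t _ _ ij).
by have [] := ht i.
Qed.

End Ramsey.

(** * Ultimately periodic members and the choice of regular predicates *)

Lemma recognizable_ultimately_periodic (S : finType) (K : set (omega_word S)) x :
  recognizable K -> K x -> exists2 y, K y & ultimately_periodic y.
Proof.
move=> [M [h hK]] Kx.
have [t dt [a ha]] :=
  ramsey (fun i j => h [seq x k | k <- index_iota i.+1 j.+1]).
(* Shifted by one so that the first factor is nonempty even if [t 0 = 0]. *)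
pose s j := if j is j'.+1 then (t j').+1 else 0.
have cs : cuts s by split=> // -[|j] //=; rewrite ltnS.
have hs j : h (factor x s j.+1) = a by exact: ha.
pose d := s 2 - s 1.
have d0 : 0 < d by rewrite subn_gt0; case: cs.
(* With w0 and w1 the first two factors of [x], [y] is w0 w1 w1 w1 ..., and [s'] below cuts it
   before each copy of w1. *)
pose y i := if i < s 1 then x i else x (s 1 + (i - s 1) %% d).
pose s' j := if j is j'.+1 then s 1 + j' * d else 0.
have cs' : cuts s'.
  by split=> // -[|j]; rewrite /s' ?mul0n // ltn_add2l ltn_pmul2r.
exists y.
  apply: (hK s s' x) => // -[|j].
    congr h; rewrite /factor /s' mul0n addn0.
    by apply/eq_in_map => i; rewrite mem_index_iota /y => /andP[_ ->].
  rewrite hs -(hs 0); congr h.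
  have sz : s' j.+2 - s' j.+1 = d by rewrite /s' subnDl -mulnBl subSnn mul1n.
  apply: (@eq_from_nth _ (x 0)); rewrite !size_factor ?sz // => i hi.
  rewrite !nth_factor ?sz //.
  by rewrite /y /s' -addnA (ltnNge _ (s 1)) leq_addr /= addKn modnMDl modn_small.
exists (s 1), d; split=> // i hi; rewrite /y.
rewrite !(ltnNge _ (s 1)) hi (leq_trans hi (leq_addr _ _)) /=.
by rewrite -addnBAC // modnDr.
Qed.

Theorem mainTheorem5 (A : finType) (l : nat) (phi : mso_sentence A l)
    (P : 'I_l -> set nat) :
  omega_regular (mso_language phi P) ->
  exists Q : 'I_l -> set nat,
    (forall i : 'I_l, regular_predicate (Q i)) /\
    mso_language phi P = mso_language phi Q.
Proof.
move=> [B LB]; have [K rK hK] := definable_sat phi.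
pose word (Q : 'I_l -> set nat) : omega_word {ffun 'I_l -> bool} :=
  fun i => [ffun k => `[< Q k i >]].
(* [f] adds the empty variable tracks and swaps the components: the letter of [A] comes second so
   that the quantifier over [u] can project it away. *)
pose f (a : {ffun 'I_l -> bool} * A) : letter A l 0 0 :=
  (a.2, a.1, [ffun k : 'I_0 => false], [ffun k : 'I_0 => false]).
have fE u Q : f \o (fun i => (word Q i, u i)) =
    encode u Q (fun _ : 'I_0 => 0) (fun _ : 'I_0 => set0).
  by apply/funext => i; rewrite /f /encode /=; congr (_, _, _); apply/ffunP => -[].
(* [E] holds the words encoding predicates with which [phi] defines the language of [B]. Regularity
   of that language makes [E] recognizable. *)
pose E := [set p : omega_word {ffun 'I_l -> bool} | forall u : omega_word A,
  buchi_language B u <-> K (f \o (fun i => (p i, u i)))].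
have rE : recognizable E.
  exact: recognizable_forall (recognizable_iff
    (recognizable_preimage snd (recognizable_buchi B))
    (recognizable_preimage f rK)).
have EP : E (word P) by move=> u; rewrite fE hK -LB.
have [q Eq [N [p [p0 perq]]]] := recognizable_ultimately_periodic rE EP.
(* Every word over these letters encodes a tuple of predicates, and each [Q k] inherits the
   threshold [N] and the period [p]. *)
pose Q k := [set i | q i k].
have qE : q = word Q.
  by apply/funext => i; apply/ffunP => k; rewrite ffunE asboolb.
exists Q; split=> [k|].
  have memQ i : (i \in Q k) = q i k by apply/idP/idP; rewrite in_setE.
  by exists N, p; split=> // i Ni; rewrite /char_word !memQ perq.
by rewrite LB; apply/predeqP => u; rewrite (Eq u) qE fE hK.
Qed.
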